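(* The ``Standard Thirds'' system $(t,s)=(4,3)$, the ``Far Wide Thirds'' system $(t,s)=(11,8)$ and the ``Far Narrow Thirds'' system $(t,s)=(10,9)$ (all with $q=7$) are isomorphic to distinct cyclic $12_3$ configurations of the Al-Azemi–Betten (Daublebsky von Sterneck) census, as follows: \begin{itemize} \item the $(4,3)$ system has generating set $\{0,1,4\}$, its Levi graph has automorphism group of order $24$, the configuration has automorphism group order (Ago) $12$, and it is the configuration $D_{222}$; \item the $(11,8)$ system has generating set $\{0,1,5\}$, its Levi graph has automorphism group of order $48$, the configuration has Ago $24$, and it is the configuration $D_{226}$; \item the $(10,9)$ system has generating set $\{0,1,3\}$, its Levi graph has automorphism group of order $24$, the configuration has Ago $12$, and it is the configuration $D_{228}$. \end{itemize}
   Context: For a three-element subset (offset) $S\subset\mathbb{Z}_n$, the Levi graph $L_n(S)$ is the bipartite graph with points $P_0,\dots,P_{n-1}$ and lines $L_0,\dots,L_{n-1}$, indices in $\mathbb{Z}_n$, and edges $P_i\sim L_{i+\sigma}$ for all $i\in\mathbb{Z}_n$, $\sigma\in S$. Automorphisms of a Levi graph are graph automorphisms which either preserve both the set of points and the set of lines, or interchange them. A 12-TET harmonic system with thirds $(t,s)$ and generator $q=t+s\bmod 12$ has Major chords $M_k=\{k,k+t,k+q\}$ and minor chords $m_k=\{k,k+s,k+q\}$, $k\in\mathbb{Z}_{12}$, regarded as 24 distinct vertices; in its Levi graph $M_k$ is adjacent to $m_k,m_{k+t},m_{k-s}$. So the Levi graph is $L_{12}(\{0,t,12-s\})$. A symmetric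 configuration $12_3$ is an incidence structure with 12 points and 12 lines, each point on exactly 3 lines, each line containing exactly 3 points, and any two distinct points on at most one common line (equivalently, its incidence (Levi) graph has girth at least 6). It is cyclic if it admits an automorphism permuting the points, and the lines, in a single cycle of length 12; the configuration with generating set (starter) $S\subset\mathbb{Z}_{12}$ is the one with Levi graph $L_{12}(S)$. A system is isomorphic to a configuration if its Levi graph is isomorphic to that of the configuration. ``Ago'' is the order of the group of automorphisms of the configuration (permutations of points and lines preserving incidence, points mapped to points and lines to lines). The census of Al-Azemi and Betten (``The configurations $12_3$ revisited'', J. Geometry 105 (2014)) lists the 229 isomorphism classes of connected symmetric configurations $12_3$ as $D_1,\dots,D_{229}$. The three classes in question are characterized in the census as follows: $D_{226}$ is the unique cyclic configuration with Ago $24$; $D_{222}$ is the cyclic configuration with Ago $12$ having starter $\{0,1,4\}$; $D_{228}$ is the cyclic configuration with Ago $12$ having starter $\{0,1,3\}$. *)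

(* Defs.v *)
(* Mathematical Components *)
From HB Require Import structures.
From mathcomp Require Import all_boot all_order all_algebra all_fingroup.
Set Implicit Arguments.
Unset Strict Implicit.
Unset Printing Implicit Defensive.
Import GRing.Theory.
Local Open Scope ring_scope.

Record incidence := Incidence {
  point : finType;
  line : finType;
  inc : point -> line -> bool
}.

Definition vertex (X : incidence) : finType := (point X + line X)%type.

Definition levi_adj (X : incidence) : rel (vertex X) := fun u v =>
  match u, v with
  | inl p, inr l | inr l, inl p => inc p l
  | _, _ => false
  end.

Definition is_line (X : incidence) (v : vertex X) : bool :=
  if v is inr _ then true else false.

(* The convention on automorphisms of Levi graphs: the bipartition is either
   preserved or interchanged. *)
Definition levi_aut (X : incidence) : {set {perm vertex X}} :=
  [set g : {perm vertex X} |
    [forall u, forall v, levi_adj (g u) (g v) == levi_adj u v] &&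
    ([forall v, is_line (g v) == is_line v]
     || [forall v, is_line (g v) == ~~ is_line v])].

Lemma levi_aut_group_set (X : incidence) : group_set (levi_aut X).
Proof.
apply/group_setP; split.
  rewrite inE; apply/andP; split.
    by apply/forallP => u; apply/forallP => v; rewrite !perm1.
  by apply/orP; left; apply/forallP => v; rewrite perm1.
move=> g h; rewrite !inE => /andP[/forallP ag sg] /andP[/forallP ah sh].
apply/andP; split.
  apply/forallP => u; apply/forallP => v; rewrite !permM.
  by rewrite (eqP (forallP (ah _) _)) (eqP (forallP (ag _) _)).
case/orP: sg => /forallP sg; case/orP: sh => /forallP sh; apply/orP;
  [left | right | right | left];
  by apply/forallP => v; rewrite permM (eqP (sh _)) (eqP (sg _)) ?negbK.
Qed.

Canonical levi_aut_group (X : incidence) := Group (levi_aut_group_set X).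

Definition levi_iso (X Y : incidence) : Prop :=
  exists2 f : vertex X -> vertex Y, bijective f &
    forall u v, levi_adj (f u) (f v) = levi_adj u v.

Definition levi_connected (X : incidence) : Prop :=
  forall u v : vertex X, connect (@levi_adj X) u v.

Definition config_aut (X : incidence) : {set {perm point X} * {perm line X}} :=
  [set g : {perm point X} * {perm line X} |
    [forall p, forall l, inc (g.1 p) (g.2 l) == inc p l]].

Lemma config_aut_group_set (X : incidence) : group_set (config_aut X).
Proof.
apply/group_setP; split.
  by rewrite inE; apply/forallP => p; apply/forallP => l; rewrite !perm1.
move=> g h; rewrite !inE => /forallP ag /forallP ah.
apply/forallP => p; apply/forallP => l; rewrite !permM.
by rewrite (eqP (forallP (ah _) _)) (eqP (forallP (ag _) _)).
Qed.

Canonical config_aut_group (X : incidence) := Group (config_aut_group_set X).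

Definition ago (X : incidence) : nat := #|config_aut X|.

Definition config_iso (X Y : incidence) : Prop :=
  exists (f : point X -> point Y) (g : line X -> line Y),
    [/\ bijective f, bijective g &
        forall p l, inc (f p) (g l) = inc p l].

Definition configuration_12_3 (X : incidence) : Prop :=
  [/\ #|point X| = 12%N,
      #|line X| = 12%N,
      forall p : point X, #|[set l | inc p l]| = 3%N,
      forall l : line X, #|[set p | inc p l]| = 3%N &
      forall (p q : point X) (l m : line X), p != q ->
        inc p l -> inc q l -> inc p m -> inc q m -> l = m].

Definition cyclic_config (X : incidence) : Prop :=
  exists2 g, g \in config_aut X &
    (forall p, porbit g.1 p = [set: point X]) /\
    (forall l, porbit g.2 l = [set: line X]).

(* The incidence structure with Levi graph L_n(S).  As 'Z_n is the ring of
   integers mod n only when 1 < n, it is meant for such n. *)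
Definition offset_config (n : nat) (S : {set 'Z_n}) : incidence :=
  Incidence (fun i j : 'Z_n => j \in [set i + a | a in S]).

Definition has_starter (X : incidence) (S : {set 'Z_12}) : Prop :=
  config_iso X (offset_config S).

Definition generator (t s : 'Z_12) : 'Z_12 := t + s.

Definition major_chord (t s k : 'Z_12) : {set 'Z_12} :=
  [set k; k + t; k + generator t s].

Definition minor_chord (t s k : 'Z_12) : {set 'Z_12} :=
  [set k; k + s; k + generator t s].

(* The points are the major chords M_k and the lines the minor chords m_k.
   Chords are represented by their index k rather than by their set of notes,
   so that there are 24 distinct vertices for every choice of thirds. *)
Definition harmonic_system (t s : 'Z_12) : incidence :=
  Incidence (fun k j : 'Z_12 => j \in [set k; k + t; k - s]).

(* Each edge M_k -- m_j keeps two of the three notes of the chord. *)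
Lemma harmonic_system_notes (t s k : 'Z_12) :
  [/\ [set k; k + generator t s]
        \subset major_chord t s k :&: minor_chord t s k,
      [set k + t; k + generator t s]
        \subset major_chord t s k :&: minor_chord t s (k + t) &
      [set k; k + t]
        \subset major_chord t s k :&: minor_chord t s (k - s)].
Proof.
rewrite /major_chord /minor_chord /generator.
split; apply/subsetP => x; rewrite !inE => /orP[] /eqP->;
  by rewrite ?addrA ?subrK ?[k - s + t]addrAC ?subrK ?eqxx ?orbT.
Qed.

Lemma harmonic_system_offset (t s k j : 'Z_12) :
  @inc (harmonic_system t s) k j
  = @inc (offset_config [set 0; t; 12%:R - s]) k j.
Proof.
have -> : 12%:R = 0 :> 'Z_12 by apply/val_inj.
by rewrite /= sub0r !imsetU !imset_set1 addr0.
Qed.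

Definition system_isomorphic (t s : 'Z_12) (X : incidence) : Prop :=
  levi_iso (harmonic_system t s) X.

(* The classes listed by the census of Al-Azemi and Betten; each D_i is given
   as a predicate on configurations, invariant under config_iso. *)
Definition in_census (X : incidence) : Prop :=
  configuration_12_3 X /\ levi_connected X.

Definition D222 (X : incidence) : Prop :=
  [/\ in_census X, cyclic_config X, ago X = 12%N &
      has_starter X [set 0; 1; 4]].

Definition D226 (X : incidence) : Prop :=
  [/\ in_census X, cyclic_config X, ago X = 24%N &
      forall Y, in_census Y -> cyclic_config Y -> ago Y = 24%N ->
        config_iso Y X].

Definition D228 (X : incidence) : Prop :=
  [/\ in_census X, cyclic_config X, ago X = 12%N &
      has_starter X [set 0; 1; 3]].

(* Main.v *)
Require Import Defs.
From mathcomp Require Import all_boot all_order all_algebra all_fingroup.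
Set Implicit Arguments.
Unset Strict Implicit.
Unset Printing Implicit Defensive.
Import GRing.Theory.
Local Open Scope ring_scope.

(** The Levi graph of the [(t, s)] system is that of the offset configuration
    of [{0, t, -s}], so everything takes place among the offset configurations
    of Z_12.

    An affine map [z |-> u z + c] with [u] a unit that carries [S] onto [T]
    yields an isomorphism between the configurations of [S] and [T]: take
    [x |-> u x] on points and [y |-> u y + c] on lines.  This moves
    [{0, 4, -3}], [{0, 11, -8}] and [{0, 10, -9}] to [{0, 1, 4}], [{0, 1, 5}]
    and [{0, 1, 3}].

    For the automorphism groups, two points [x] and [y] of the configuration
    of [S] are collinear exactly when [y - x] lies in [S - S], so automorphisms
    induce automorphisms of a Cayley graph of Z_12.  For the three starters
    an exhaustive backtracking search ([embeddings], proved complete in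
    [mem_embeddings]) shows that the automorphisms of that graph are affine.
    An affine point map with linear part [u] extends to the lines only when
    [u S] is a translate of [S].  For these starters it must then be [S]
    itself, and the line map is given by the same formula as the point map
    ([offset_aut_affine]).  Hence Ago is 12 times the number of units [u] with
    [u S = S] ([ago_offset]): only [u = 1] for [{0, 1, 4}] and [{0, 1, 3}], but
    also [u = 5] for [{0, 1, 5}].  The same search finds no map between the
    collinearity graphs of [{0, 1, 4}] and [{0, 1, 3}], which separates these
    two configurations; Ago separates them from the third.

    Negation interchanges the points and lines of an offset configuration, so
    its Levi graph has twice as many automorphisms ([card_levi_aut]).

    The uniqueness part of [D226] is a classification: labelling points and
    lines along the given 12-cycles turns a cyclic configuration [12_3] into an
    offset configuration ([cyclic_offset]); as two points lie on at most one
    line, the nonzero differences of its starter are distinct; and every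
    such triple is affinely equivalent to one of the three starters
    ([cyclic_configuration_starter]).  Only one of them has Ago 24. *)

(** * Isomorphisms of incidence structures *)

Lemma config_iso_sym (X Y : incidence) : config_iso X Y -> config_iso Y X.
Proof.
case=> f [g [[f' fK f'K] [g' gK g'K] fg]]; exists f', g'; split.
- by exists f.
- by exists g.
- by move=> p l; rewrite -fg f'K g'K.
Qed.

Lemma config_iso_trans (X Y Z : incidence) :
  config_iso X Y -> config_iso Y Z -> config_iso X Z.
Proof.
case=> f [g [bf bg fg]] [f' [g' [bf' bg' fg']]].
exists (f' \o f), (g' \o g); split; try exact: bij_comp.
by move=> p l; rewrite fg' fg.
Qed.

Lemma config_iso_levi_iso (X Y : incidence) : config_iso X Y -> levi_iso X Y.
Proof.
case=> f [g [[f' fK f'K] [g' gK g'K] fg]].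
exists (fun u : vertex X =>
  match u with inl p => inl (f p) | inr l => inr (g l) end : vertex Y).
  exists (fun u : vertex Y =>
    match u with inl p => inl (f' p) | inr l => inr (g' l) end : vertex X).
  - by case=> x /=; rewrite ?fK ?gK.
  - by case=> x /=; rewrite ?f'K ?g'K.
by case=> x [] y /=.
Qed.

Lemma config_autP (X : incidence) (g : {perm point X} * {perm line X}) :
  reflect (forall p l, inc (g.1 p) (g.2 l) = inc p l) (g \in config_aut X).
Proof.
rewrite inE; apply: (iffP idP) => [/forallP ag p l | ag].
  by apply/eqP; move/forallP: (ag p).
by apply/forallP => p; apply/forallP => l; rewrite ag.
Qed.

(** Conjugation by the isomorphism embeds one automorphism group in the
    other. *)
Lemma config_iso_leq_ago (X Y : incidence) :
  config_iso X Y -> (ago X <= ago Y)%N.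
Proof.
case=> f [g [[f' fK f'K] [g' gK g'K] fg]].
have injP (p : {perm point X}) : injective (f \o p \o f').
  by apply: inj_comp (can_inj f'K); apply: inj_comp perm_inj; apply: can_inj fK.
have injL (q : {perm line X}) : injective (g \o q \o g').
  by apply: inj_comp (can_inj g'K); apply: inj_comp perm_inj; apply: can_inj gK.
pose conj (h : {perm point X} * {perm line X}) :=
  (perm (injP h.1), perm (injL h.2)).
have conj_inj : injective conj.
  move=> [p q] [p' q'] [/permP ep /permP eq]; congr (_, _); apply/permP => x.
    by move: (ep (f x)); rewrite !permE /= fK => /(can_inj fK).
  by move: (eq (g x)); rewrite !permE /= gK => /(can_inj gK).
rewrite /ago -(card_imset _ conj_inj); apply/subset_leq_card/subsetP => k.
case/imsetP => h /config_autP ah ->; apply/config_autP => p l.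
by rewrite !permE /= fg ah -fg f'K g'K.
Qed.

Lemma config_iso_ago (X Y : incidence) : config_iso X Y -> ago X = ago Y.
Proof.
move=> XY; apply/eqP.
by rewrite eqn_leq !config_iso_leq_ago //; apply: config_iso_sym.
Qed.

Lemma config_iso_configuration (X Y : incidence) :
  config_iso X Y -> configuration_12_3 X -> configuration_12_3 Y.
Proof.
case=> f [g [[f' fK f'K] [g' gK g'K] fg]] [cp cl pl lp uniq_line].
have inc' p l : inc (f' p) (g' l) = inc p l by rewrite -fg f'K g'K.
split.
- by rewrite -cp; apply/esym/bij_eq_card; exists f'; [apply: fK | apply: f'K].
- by rewrite -cl; apply/esym/bij_eq_card; exists g'; [apply: gK | apply: g'K].
- move=> p; rewrite -(pl (f' p)) -(card_imset _ (can_inj gK)).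
  apply: eq_card => l; rewrite inE -inc'; apply/idP/imsetP => [pl' | [m]].
    by exists (g' l); rewrite ?inE ?g'K.
  by rewrite inE => pm ->; rewrite gK.
- move=> l; rewrite -(lp (g' l)) -(card_imset _ (can_inj fK)).
  apply: eq_card => p; rewrite inE -inc'; apply/idP/imsetP => [pl' | [q]].
    by exists (f' p); rewrite ?inE ?f'K.
  by rewrite inE => qm ->; rewrite fK.
move=> p q l m pq; rewrite -!inc' => lp' lq mp mq; apply: (can_inj g'K).
by apply: uniq_line lp' lq mp mq; apply: contra_neq pq; apply: can_inj f'K _ _.
Qed.

(** * Duality and automorphisms of the Levi graph *)

Definition self_dual (X : incidence) : Prop :=
  exists (f : point X -> line X) (g : line X -> point X),
    [/\ injective f, injective g & forall p l, inc (g l) (f p) = inc p l].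

Lemma levi_adj_sym (X : incidence) (u v : vertex X) :
  levi_adj u v = levi_adj v u.
Proof. by case: u v => x [] y. Qed.

Lemma levi_autP (X : incidence) (g : {perm vertex X}) :
  reflect ((forall u v, levi_adj (g u) (g v) = levi_adj u v) /\
           exists b, forall v, is_line (g v) = b (+) is_line v)
    (g \in levi_aut X).
Proof.
rewrite inE; apply: (iffP andP) => [[/forallP ag sg] | [ag [b sg]]]; split.
- by move=> u v; apply/eqP; move/forallP: (ag u).
- by case/orP: sg => /forallP sg; [exists false | exists true];
    move=> v; rewrite (eqP (sg v)).
- by apply/forallP => u; apply/forallP => v; rewrite ag.
- case: b sg => sg; apply/orP; [right | left];
    by apply/forallP => v; rewrite sg.
Qed.

(** The automorphisms that preserve the two sides are the pairs in [config_aut],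
    acting side by side.  A duality carries this subgroup onto its only other
    coset, that of the automorphisms which exchange the sides.  The point [p0]
    is needed because on the empty structure the two cosets coincide. *)
Lemma card_levi_aut (X : incidence) (p0 : point X) :
  self_dual X -> #|levi_aut X| = (2 * ago X)%N.
Proof.
case=> f [g [f_inj g_inj fg]].
pose dual (u : vertex X) : vertex X :=
  match u with inl p => inr (f p) | inr l => inl (g l) end.
have dual_inj : injective dual.
  by move=> [x|x] [y|y] //= [] => [/f_inj|/g_inj] ->.
pose d := perm dual_inj.
have adj_dual u v : levi_adj (d u) (d v) = levi_adj u v.
  by rewrite !permE; case: u v => [x|x] [y|y] //=.
have line_dual v : is_line (d v) = ~~ is_line v by rewrite permE; case: v.
have d_aut : d \in levi_aut X.
  by apply/levi_autP; split=> //; exists true.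
pose side (u : vertex X) (h : {perm point X} * {perm line X}) : vertex X :=
  match u with inl p => inl (h.1 p) | inr l => inr (h.2 l) end.
have side_inj h : injective (side^~ h).
  by move=> [x|x] [y|y] //= [] /perm_inj ->.
pose lift h := perm (side_inj h).
have lift_inj : injective lift.
  move=> [p q] [p' q'] /permP e; congr (_, _); apply/permP => x.
    by move: (e (inl x)); rewrite !permE /= => -[].
  by move: (e (inr x)); rewrite !permE /= => -[].
have liftE h v : is_line (lift h v) = is_line v by rewrite permE; case: v.
have aut_lift h : (lift h \in levi_aut X) = (h \in config_aut X).
  apply/levi_autP/config_autP => [[ah _] p l | ah].
    by move: (ah (inl p) (inr l)); rewrite !permE.
  split; last by exists false => v; rewrite liftE.
  by move=> [p|l] [p'|l']; rewrite !permE /= ?ah.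
have lift_onto k : k \in levi_aut X -> (forall v, is_line (k v) = is_line v) ->
    k \in lift @: config_aut X.
  move=> ka ks.
  have kl p : {q | k (inl p) = inl q}.
    by case E: (k (inl p)) (ks (inl p)) => [q|] // _; exists q.
  have kr l : {m | k (inr l) = inr m}.
    by case E: (k (inr l)) (ks (inr l)) => [|m] // _; exists m.
  have kl_inj : injective (fun p => sval (kl p)).
    move=> p q e; suff: inl p = inl q :> vertex X by case.
    by apply: (@perm_inj _ k); rewrite (svalP (kl p)) (svalP (kl q)) e.
  have kr_inj : injective (fun l => sval (kr l)).
    move=> p q e; suff: inr p = inr q :> vertex X by case.
    by apply: (@perm_inj _ k); rewrite (svalP (kr p)) (svalP (kr q)) e.
  have kE : k = lift (perm kl_inj, perm kr_inj).
    apply/permP => -[x|x]; rewrite permE /= permE.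
      exact: (svalP (kl x)).
    exact: (svalP (kr x)).
  by rewrite kE; apply: imset_f; rewrite -aut_lift -kE.
have -> : levi_aut X = lift @: config_aut X
                   :|: [set k * d | k in lift @: config_aut X]%g.
  apply/setP => k; rewrite in_setU; apply/idP/orP => [ka | ].
    have /levi_autP[_ [[] ks]] := ka; [right | left]; last exact: lift_onto.
    apply/imsetP; exists (k * d^-1)%g; last by rewrite mulgKV.
    apply: lift_onto => [|v]; first by rewrite groupMr ?groupV.
    by apply: negb_inj; rewrite permM -line_dual permKV ks.
  case=> [|/imsetP[{}k kl ->]].
    by case/imsetP => h hc ->; rewrite aut_lift.
  by case/imsetP: kl => h hc ->; rewrite groupMl ?aut_lift.
rewrite cardsU (_ : _ :&: _ = set0) ?cards0 ?subn0; last first.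
  apply/setP => k; rewrite !inE; apply/negP => /andP[/imsetP[h _ ->]].
  case/imsetP => _ /imsetP[h' _ ->] /permP/(_ (inl p0)) /(congr1 (@is_line X)).
  by rewrite liftE permM line_dual liftE.
by rewrite (card_imset _ (mulIg d)) card_imset // addnn mul2n.
Qed.

(** * Offset configurations *)

Lemma offset_incE n (S : {set 'Z_n}) (i j : 'Z_n) :
  @inc (offset_config S) i j = (j - i \in S).
Proof.
apply/imsetP/idP => [[a aS ->] | jS]; first by rewrite addrC addKr.
by exists (j - i); rewrite // addrC subrK.
Qed.

Lemma offset_self_dual n (S : {set 'Z_n}) : self_dual (offset_config S).
Proof.
exists -%R, -%R; split; try exact: oppr_inj.
by move=> i j; rewrite !offset_incE opprK addrC.
Qed.

Lemma offset_affine_iso n (S T : {set 'Z_n}) (u c : 'Z_n) :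
    u \is a GRing.unit -> (forall z, (u * z + c \in T) = (z \in S)) ->
  config_iso (offset_config S) (offset_config T).
Proof.
move=> uU ST; exists ( *%R u), (fun y => u * y + c); split.
- by exists ( *%R u^-1) => x; rewrite /= ?mulKr ?mulVKr.
- exists (fun y => u^-1 * (y - c)) => x;
    by rewrite /= ?addrK ?mulKr ?mulVKr ?subrK.
by move=> i j; rewrite !offset_incE -ST mulrBr addrAC.
Qed.

Definition translation n (c : 'Z_n) : {perm 'Z_n} := perm (addrI c).

Lemma offset_cyclic n (S : {set 'Z_n}) : cyclic_config (offset_config S).
Proof.
have orbit (p : 'Z_n) : porbit (translation (1 : 'Z_n)) p = setT.
  apply/setP => q; rewrite inE; apply/porbitP; exists (q - p : 'Z_n).
  have tE k x : (translation 1%R ^+ k)%g x = k%:R + x :> 'Z_n.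
    elim: k x => [|k IHk] x; first by rewrite expg0 perm1 add0r.
    by rewrite expgSr permM IHk permE addrA mulrS.
  by rewrite tE natr_Zp subrK.
exists (translation 1, translation 1) => //; apply/config_autP => i j.
by rewrite !offset_incE !permE opprD addrACA subrr add0r.
Qed.

(** Labelling the points and the lines by their position on the two cycles
    turns the given automorphism into [i |-> i + 1].  Incidence between labels
    is then invariant under translation, hence depends on the difference
    only; the starter collects the lines through the point labelled 0. *)
Lemma cyclic_offset n (X : incidence) :
    (1 < n)%N -> #|point X| = n -> #|line X| = n -> cyclic_config X ->
  exists S : {set 'Z_n}, config_iso X (offset_config S).
Proof.
move=> n1 cp cl [[a b] /config_autP ab [/= oa ob]].
have card_Zn : #|'Z_n| = n by rewrite card_ord Zp_cast.
have orbit_bij (T : finType) (h : {perm T}) (x : T) : #|T| = n ->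
    porbit h x = setT ->
    bijective (fun i : 'Z_n => (h ^+ i)%g x) /\
    forall i j : 'Z_n, (h ^+ (i + j)%R)%g x = (h ^+ i)%g ((h ^+ j)%g x).
  move=> cT ox; have ord : #|porbit h x| = n by rewrite ox cardsT.
  split.
    apply: inj_card_bij; last by rewrite cT card_Zn.
    move=> i j /eqP; rewrite !permX => e.
    have ltn (k : 'Z_n) : (k < #|porbit h x|)%N.
      by rewrite ord -[X in (_ < X)%N](Zp_cast n1).
    apply/val_inj/eqP.
    rewrite -(nth_uniq x _ _ (uniq_traject_porbit h x)) ?size_traject ?ltn //.
    by rewrite !nth_traject ?ltn.
  move=> i j; rewrite -permM -expgD.
  have -> : ((i + j)%R : nat) = ((i + j) %% n)%N.
    by rewrite -[X in (_ %% X)%N](Zp_cast n1).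
  rewrite !permX [in LHS]addnC; set m := addn j i.
  rewrite [in RHS](divn_eq m n) [in RHS]addnC iterD; congr iter.
  by elim: (m %/ n)%N => //= k IHk; rewrite mulSn iterD -IHk -ord iter_porbit.
have p0 : point X by move: cp n1; case: (pickP (point X)) => // /eq_card0-> <-.
have l0 : line X by move: cl n1; case: (pickP (line X)) => // /eq_card0-> <-.
have [fb _] := orbit_bij _ a p0 cp (oa p0).
have [gb gD] := orbit_bij _ b l0 cl (ob l0).
exists [set z : 'Z_n | inc p0 ((b ^+ z)%g l0)]; apply: config_iso_sym.
exists (fun i : 'Z_n => (a ^+ i)%g p0), (fun i : 'Z_n => (b ^+ i)%g l0).
split=> // i j; rewrite offset_incE inE.
have abX k p l : inc ((a ^+ k)%g p) ((b ^+ k)%g l) = inc p l.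
  elim: k => [|k IHk]; first by rewrite !expg0 !perm1.
  by rewrite !expgSr !permM ab.
by rewrite -[RHS](abX i) -gD addrC subrK.
Qed.

(** Also known as modular Golomb rulers.  The case [a = b] exempts the zero
    differences, which all coincide. *)
Definition sidon n (S : {set 'Z_n}) : Prop :=
  forall a b c d, a \in S -> b \in S -> c \in S -> d \in S ->
    a - b = c - d -> a = b \/ a = c.

(** A second line through two points [p] and [q] is a second way to write
    [q - p] as a difference of two elements of [S]. *)
Lemma offset_configurationP (S : {set 'Z_12}) :
  configuration_12_3 (offset_config S) <-> #|S| = 3%N /\ sidon S.
Proof.
have lines_through (p : 'Z_12) : #|[set l | @inc (offset_config S) p l]| = #|S|.
  rewrite -(card_imset (mem S) (addrI p)); apply: eq_card => l.
  by rewrite inE.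
split=> [[_ _ pl _ uniq_line] | [cS sidS]].
  split; first by rewrite -(lines_through 0) pl.
  move=> a b c d aS bS cS dS abcd; have [-> | ab] := eqVneq a b; first by left.
  right; apply: (uniq_line 0 (a - b)); rewrite ?offset_incE ?subr0 //.
  - by rewrite eq_sym subr_eq0.
  - by rewrite opprB addrC subrK.
  - by rewrite abcd opprB addrC subrK.
split; rewrite ?card_ord //.
- by move=> p; rewrite lines_through.
- move=> l; rewrite -[RHS]cS -(card_imset (mem S) (subrI l)).
  apply: eq_card => p; rewrite inE offset_incE; apply/idP/imsetP => [lS | [a aS ->]].
    by exists (l - p); rewrite ?subKr.
  by rewrite subKr.
move=> p q l m; rewrite !offset_incE => pq lp lq mp mq.
have [|/addrI/oppr_inj pq' | /addIr //] := sidS _ _ _ _ lp lq mp mq.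
  have sub2l x : (x - p) - (x - q) = q - p :> 'Z_12.
    by rewrite opprB addrC addrA subrK.
  by rewrite !sub2l.
by rewrite pq' eqxx in pq.
Qed.

(** The path from point [k] to point [k + 1] runs through line [k + 1]. *)
Lemma offset_connected n (S : {set 'Z_n}) :
  0 \in S -> 1 \in S -> levi_connected (offset_config S).
Proof.
move=> S0 S1; set X := offset_config S.
have csym : connect_sym (@levi_adj X).
  by apply: sym_connect_sym => u v; exact: levi_adj_sym.
have to0 (i : 'Z_n) : connect (@levi_adj X) (inl 0) (inl i).
  rewrite -[i]natr_Zp; elim: (i : nat) => // k IHk.
  apply: connect_trans IHk _.
  apply: (@connect_trans _ _ (inr (k.+1%:R : 'Z_n) : vertex X));
    apply: connect1.
    by rewrite /levi_adj offset_incE mulrSr addrC addKr.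
  by rewrite /levi_adj offset_incE subrr.
have conn0 u : connect (@levi_adj X) (inl 0) u.
  case: u => i //; apply: connect_trans (to0 i) _; apply: connect1.
  by rewrite /levi_adj offset_incE subrr.
move=> u v; apply: (@connect_trans _ _ (inl 0 : vertex X)) => //.
by rewrite csym.
Qed.

(** * Maps between collinearity graphs *)

(** Backtracking search for the injective maps from [dom] to [cod] that
    transport [r] to [r'], each given by its list of values; the last entries
    of [dom] are assigned first.  Comparing a new entry [x] with the earlier
    ones in one order only suits symmetric relations such as collinearity. *)
Fixpoint embeddings (T T' : eqType) (r : rel T) (r' : rel T')
    (cod : seq T') (dom : seq T) : seq (seq T') :=
  if dom is x :: dom' then
    [seq y :: t | t <- embeddings r r' cod dom',
                  y <- [seq y <- cod | (y \notin t) &&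
                     all2 (fun x' y' => r x x' == r' y y') dom' t]]
  else [:: [::]].

Lemma mem_embeddings (T T' : eqType) (r : rel T) (r' : rel T')
    (cod : seq T') (dom : seq T) (f : T -> T') :
    injective f -> (forall x, f x \in cod) ->
    (forall x y, r' (f x) (f y) = r x y) -> uniq dom ->
  map f dom \in embeddings r r' cod dom.
Proof.
move=> f_inj f_cod fr; elim: dom => //= x dom IHdom /andP[xdom udom].
apply/allpairsPdep; exists (map f dom), (f x); split=> //; first exact: IHdom.
rewrite mem_filter f_cod mem_map // xdom andbT /=.
by elim: dom {IHdom xdom udom} => //= y dom IHdom; rewrite fr eqxx.
Qed.

(** An enumeration of Z_12 which, unlike [enum], reduces by computation. *)
Definition residues : seq 'Z_12 := [seq inZp i | i <- iota 0 12].

Lemma mem_residues x : x \in residues.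
Proof.
apply/mapP; exists (x : nat); first by rewrite mem_iota ltn_ord.
by rewrite valZpK.
Qed.

Definition differences n (s : seq 'Z_n) : seq 'Z_n :=
  [seq a - b | a <- s, b <- s].

Lemma offset_collinearP n (s : seq 'Z_n) (x y : 'Z_n) :
  reflect (exists j, @inc (offset_config [set:: s]) x j
                  && @inc (offset_config [set:: s]) y j)
    (y - x \in differences s).
Proof.
apply: (iffP allpairsP) => [[[a b] [sa sb e]] | [j]].
  exists (x + a); rewrite !offset_incE !inE [x + a - x]addrC addKr.
  have -> : y = x + (a - b) by rewrite -[a - b]e addrC subrK.
  by rewrite opprD addrACA subrr add0r subKr; apply/andP.
rewrite !offset_incE !inE => /andP[jx jy]; exists (j - x, j - y); split=> //=.
by rewrite opprB [RHS]addrC addrA subrK.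
Qed.

Lemma offset_iso_differences n (s t : seq 'Z_n) (f g : 'Z_n -> 'Z_n) :
    bijective g ->
    (forall i j, @inc (offset_config [set:: t]) (f i) (g j)
               = @inc (offset_config [set:: s]) i j) ->
  forall x y, (f y - f x \in differences t) = (y - x \in differences s).
Proof.
move=> [g' gK g'K] fg x y.
apply/offset_collinearP/offset_collinearP => -[j].
  by rewrite -[j]g'K !fg; exists (g' j).
by rewrite -!fg; exists (g j).
Qed.

(** Collinearity in the configuration of [s] is the Cayley graph of Z_12 with
    connection set [differences s], so the point map of every isomorphism from
    the configuration of [s] to that of [t] is in this list. *)
Definition tables (s t : seq 'Z_12) : seq (seq 'Z_12) :=
  embeddings (fun x y => y - x \in differences s)
    (fun x y => y - x \in differences t) residues residues.

Lemma offset_iso_table (s t : seq 'Z_12) (f g : 'Z_12 -> 'Z_12) :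
    bijective f -> bijective g ->
    (forall i j, @inc (offset_config [set:: t]) (f i) (g j)
               = @inc (offset_config [set:: s]) i j) ->
  map f residues \in tables s t.
Proof.
move=> f_bij g_bij fg; apply: mem_embeddings; first exact: bij_inj.
- by move=> x; apply: mem_residues.
- exact: (offset_iso_differences g_bij fg).
rewrite map_inj_in_uniq ?iota_uniq // => i j; rewrite !mem_iota => i12 j12.
by move/(congr1 val); rewrite /= !modn_small.
Qed.

(** * Affine automorphisms *)

(** An affine map is determined by its values at 0 and 1, the first two entries
    of its table. *)
Definition affine_table (t : seq 'Z_12) : bool :=
  t == [seq (t`_1 - t`_0) * x + t`_0 | x <- residues].

Lemma affine_tableE (f : 'Z_12 -> 'Z_12) :
  affine_table (map f residues) -> forall x, f x = (f 1 - f 0) * x + f 0.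
Proof.
have nthE (i : nat) : (i < 12)%N -> (map f residues)`_i = f (inZp i).
  move=> i12; rewrite (nth_map 0) ?size_map ?size_iota //.
  by rewrite (nth_map 0%N) ?size_iota // nth_iota.
rewrite /affine_table !nthE // => /eqP/eq_in_map e x.
have -> : 0 = inZp 0 :> 'Z_12 by apply: val_inj.
have -> : 1 = inZp 1 :> 'Z_12 by apply: val_inj.
exact: e (mem_residues x).
Qed.

Definition affine_preim (s t : seq 'Z_12) (u c : 'Z_12) : bool :=
  all (fun z => (u * z + c \in t) == (z \in s)) residues.

(** Besides saying that [U] lists the units [u] with [u s = s], this forbids
    [u s + d = s] for every nonzero [d]: an automorphism then acts on points and
    on lines by the same affine map, not by two translates of it. *)
Definition multipliers (s U : seq 'Z_12) : bool :=
  [&& uniq U, all (fun u => u \is a GRing.unit) U &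
    all (fun u => all (fun d => affine_preim s s u d == (u \in U) && (d == 0))
      residues) residues].

Lemma affine_preimP (s t : seq 'Z_12) u c :
  reflect (forall z, (u * z + c \in t) = (z \in s)) (affine_preim s t u c).
Proof.
apply: (iffP allP) => [e z | e z _]; last by rewrite e.
exact/eqP/e/mem_residues.
Qed.

(** Once [f] is affine with linear part [u], incidence says that
    [z |-> u z + d], with [d := g j - (u j + f 0)], preserves [s]; this
    forces [d = 0] for every line [j]. *)
Lemma offset_aut_affine (s U : seq 'Z_12) (f g : 'Z_12 -> 'Z_12) :
    all affine_table (tables s s) -> multipliers s U ->
    bijective f -> bijective g ->
    (forall i j, @inc (offset_config [set:: s]) (f i) (g j)
               = @inc (offset_config [set:: s]) i j) ->
  exists2 u, u \in U & forall x, f x = u * x + f 0 /\ g x = u * x + f 0.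
Proof.
move=> /allP aff /and3P[_ _ /allP mul] f_bij g_bij fg.
have := affine_tableE (aff _ (offset_iso_table f_bij g_bij fg)).
set u := f 1 - f 0 => fE.
have shift j : (u \in U) && (g j - (u * j + f 0) == 0).
  move/allP: (mul u (mem_residues u)).
  move/(_ (g j - (u * j + f 0)) (mem_residues _)) => /eqP <-.
  apply/affine_preimP => z; move: (fg (j - z) j).
  rewrite !offset_incE !inE fE subKr => <-.
  by rewrite mulrBr addrAC opprB addrCA.
exists u => [|x]; first by case/andP: (shift 0).
by split=> //; case/andP: (shift x) => _; rewrite subr_eq0 => /eqP.
Qed.

(** An automorphism corresponds to its linear part, a multiplier, and its
    translation part, an arbitrary residue. *)
Lemma ago_offset (s U : seq 'Z_12) :
    all affine_table (tables s s) -> multipliers s U ->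
  ago (offset_config [set:: s]) = (12 * size U)%N.
Proof.
set X := offset_config _ => aff mul.
have aut_affine h : h \in config_aut X ->
    exists2 u, u \in U &
      forall x, h.1 x = u * x + h.1 0 /\ h.2 x = u * x + h.1 0.
  move=> /config_autP ha; apply: offset_aut_affine aff mul _ _ ha.
    by exists (h.1^-1)%g => x; rewrite ?permK ?permKV.
  by exists (h.2^-1)%g => x; rewrite ?permK ?permKV.
case/and3P: mul => U_uniq /allP U_unit /allP mul.
pose phi (h : {perm 'Z_12} * {perm 'Z_12}) := (h.1 1 - h.1 0, h.1 0).
have phi_inj : {in config_aut X &, injective phi}.
  move=> h k /aut_affine[u _ hE] /aut_affine[v _ kE] /eqP.
  rewrite xpair_eqE => /andP[/eqP euv /eqP e0].
  rewrite (hE 1).1 (kE 1).1 !addrK !mulr1 in euv.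
  case: h k hE kE e0 => [h1 h2] [k1 k2] /= hE kE e0.
  congr (_, _); apply/permP => x.
    by rewrite (hE x).1 (kE x).1 euv e0.
  by rewrite (hE x).2 (kE x).2 euv e0.
rewrite /ago -(card_in_imset phi_inj).
rewrite (_ : [set _ | _ in _] = setX [set:: U] setT); last first.
  apply/setP => -[u c]; rewrite !inE andbT; apply/imsetP/idP.
    case=> h /aut_affine[v vU hE] [-> _].
    by rewrite (hE 1).1 addrK mulr1.
  move=> uU; have inj : injective (fun x : 'Z_12 => u * x + c).
    by move=> x y /addIr; apply/mulrI/U_unit.
  exists (perm inj, perm inj); last first.
    by rewrite /phi !permE mulr1 mulr0 add0r addrK.
  apply/config_autP => i j; rewrite !offset_incE !permE !inE /=.
  rewrite opprD addrACA subrr addr0 -mulrBr -[u * _]addr0.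
  move/allP: (mul u (mem_residues u)) => /(_ 0 (mem_residues 0)).
  by rewrite uU eqxx => /eqP/affine_preimP.
by rewrite cardsX cardsT card_ord cardsE (card_uniqP U_uniq) mulnC.
Qed.

(** * The three starters *)

Definition sidonb (s : seq 'Z_12) : bool :=
  all (fun a => all (fun b => all (fun c => all (fun d =>
    (a - b == c - d) ==> (a == b) || (a == c)) s) s) s) s.

Lemma sidonP (s : seq 'Z_12) : reflect (sidon [set:: s]) (sidonb s).
Proof.
apply: (iffP allP) => [h a b c d | h a sa].
  rewrite !inE => /h/allP ha /ha/allP hb /hb/allP hc /hc/implyP hd /eqP/hd.
  by case/orP => /eqP; [left | right].
apply/allP => b sb; apply/allP => c sc; apply/allP => d sd.
apply/implyP => /eqP/h; rewrite !inE => /(_ sa sb sc sd).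
by case=> ->; rewrite eqxx ?orbT.
Qed.

Definition affine_equiv (s t : seq 'Z_12) : bool :=
  has (fun u => (u \is a GRing.unit) && has (affine_preim s t u) residues)
    residues.

Lemma affine_equiv_iso (s t : seq 'Z_12) :
  affine_equiv s t ->
  config_iso (offset_config [set:: s]) (offset_config [set:: t]).
Proof.
case/hasP => u _ /andP[u_unit /hasP[c _ /affine_preimP uc]].
by apply: (@offset_affine_iso _ _ _ u c) => // z; rewrite !inE.
Qed.

Definition starters : seq (seq 'Z_12) :=
  [:: [:: 0; 1; 4]; [:: 0; 1; 5]; [:: 0; 1; 3]].

(** Each of the finite verifications is left to call-by-need evaluation, which
    stops [has], [all] and [==>] as soon as their value is known. *)
Lemma sidon_triples_affine_equiv :
  all (fun a => all (fun b =>
    uniq [:: 0; a; b] && sidonb [:: 0; a; b] ==>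
     has (affine_equiv [:: 0; a; b]) starters) residues) residues.
Proof. by lazy. Qed.

(** Translating the starter makes 0 one of its elements, which leaves 144
    triples to examine. *)
Lemma cyclic_configuration_starter (X : incidence) :
    configuration_12_3 X -> cyclic_config X ->
  exists2 s, s \in starters & config_iso X (offset_config [set:: s]).
Proof.
move=> cX cycX; case: (cX) => [cp cl _ _ _].
have [S XS] := @cyclic_offset 12 X isT cp cl cycX.
have [cS _] := (offset_configurationP S).1 (config_iso_configuration XS cX).
have [x [a [b SE]]] : exists x a b, S = [set:: [:: x; a; b]].
  case E: (enum S) (cardE S) => [|x [|a [|b []]]]; rewrite cS // => _.
  by exists x, a, b; apply/setP => y; rewrite inE -E mem_enum.
have Xs : config_iso X (offset_config [set:: [:: 0; a - x; b - x]]).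
  apply: config_iso_trans XS _; apply: (@offset_affine_iso _ _ _ 1 (- x)).
    exact: unitr1.
  by move=> z; rewrite SE !inE mul1r subr_eq0 !(inj_eq (addIr _)).
have [/eqP cs /sidonP sids] :=
  (offset_configurationP _).1 (config_iso_configuration Xs cX).
have us : uniq [:: 0; a - x; b - x].
  by apply/card_uniqP; rewrite -[RHS](eqP cs) cardsE.
move/allP: sidon_triples_affine_equiv => /(_ _ (mem_residues (a - x)))/allP.
move=> /(_ _ (mem_residues (b - x)))/implyP; rewrite us sids => /(_ isT)/hasP.
case=> t tS /affine_equiv_iso st; exists t => //; exact: config_iso_trans Xs st.
Qed.

Lemma affine_tables_014 : all affine_table (tables [:: 0; 1; 4] [:: 0; 1; 4]).
Proof. by lazy. Qed.

Lemma affine_tables_015 : all affine_table (tables [:: 0; 1; 5] [:: 0; 1; 5]).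
Proof. by lazy. Qed.

Lemma affine_tables_013 : all affine_table (tables [:: 0; 1; 3] [:: 0; 1; 3]).
Proof. by lazy. Qed.

Lemma ago_014 : ago (@offset_config 12 [set:: [:: 0; 1; 4]]) = 12%N.
Proof. by apply: (@ago_offset _ [:: 1] affine_tables_014); lazy. Qed.

Lemma ago_015 : ago (@offset_config 12 [set:: [:: 0; 1; 5]]) = 24%N.
Proof. by apply: (@ago_offset _ [:: 1; 5] affine_tables_015); lazy. Qed.

Lemma ago_013 : ago (@offset_config 12 [set:: [:: 0; 1; 3]]) = 12%N.
Proof. by apply: (@ago_offset _ [:: 1] affine_tables_013); lazy. Qed.

Lemma not_config_iso_014_013 :
  ~ config_iso (@offset_config 12 [set:: [:: 0; 1; 4]])
      (@offset_config 12 [set:: [:: 0; 1; 3]]).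
Proof.
case=> f [g [f_bij g_bij fg]]; have := offset_iso_table f_bij g_bij fg.
suff -> : tables [:: 0; 1; 4] [:: 0; 1; 3] = [::] by [].
by lazy.
Qed.

Lemma starter_census (s : seq 'Z_12) : s \in starters ->
  in_census (offset_config [set:: s]).
Proof.
move=> sS; have /and5P[us /eqP s3 /sidonP sids s0 s1] :
    [&& uniq s, size s == 3, sidonb s, 0 \in s & 1 \in s].
  by move: s sS; apply/allP; lazy.
split; last by apply: offset_connected; rewrite inE.
by apply/offset_configurationP; split; rewrite // cardsE (card_uniqP us).
Qed.

Lemma set3_seq (a b c : 'Z_12) : [set a; b; c] = [set:: [:: a; b; c]].
Proof. by apply/setP => x; rewrite !inE orbA. Qed.

(** * Harmonic systems *)

Lemma harmonic_iso (t s : 'Z_12) (r : seq 'Z_12) :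
  affine_equiv [:: 0; t; - s] r ->
  config_iso (harmonic_system t s) (offset_config [set:: r]).
Proof.
move=> /affine_equiv_iso; apply: config_iso_trans.
exists id, id; split; try by exists id.
move=> i j; rewrite harmonic_system_offset set3_seq.
by have -> : 12%:R = 0 :> 'Z_12 by [apply/val_inj]; rewrite sub0r.
Qed.

Lemma card_levi_aut_harmonic (t s : 'Z_12) :
  #|levi_aut (harmonic_system t s)| = (2 * ago (harmonic_system t s))%N.
Proof.
apply: (@card_levi_aut (harmonic_system t s) (0 : 'Z_12)).
have [f [g [f_inj g_inj fg]]] := offset_self_dual [set 0; t; 12%:R - s].
by exists f, g; split=> // p l; rewrite !harmonic_system_offset.
Qed.

Theorem theorem13 :
  let C014 := @offset_config 12 [set 0; 1; 4] in
  let C015 := @offset_config 12 [set 0; 1; 5] in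
  let C013 := @offset_config 12 [set 0; 1; 3] in
  [/\ [/\ generator 4 3 = 7, generator 11 8 = 7 & generator 10 9 = 7],
      [/\ ~ config_iso C014 C015, ~ config_iso C014 C013
        & ~ config_iso C015 C013],
      [/\ system_isomorphic 4 3 C014,
          #|levi_aut (harmonic_system 4 3)| = 24%N,
          ago C014 = 12%N & D222 C014],
      [/\ system_isomorphic 11 8 C015,
          #|levi_aut (harmonic_system 11 8)| = 48%N,
          ago C015 = 24%N & D226 C015] &
      [/\ system_isomorphic 10 9 C013,
          #|levi_aut (harmonic_system 10 9)| = 24%N,
          ago C013 = 12%N & D228 C013]].
Proof.
move=> C014 C015 C013.
rewrite /D222 /D228 /has_starter {}/C014 {}/C015 {}/C013 !set3_seq.
have iso014 :
    config_iso (harmonic_system 4 3) (@offset_config 12 [set:: [:: 0; 1; 4]]).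
  by apply: harmonic_iso; lazy.
have iso015 :
    config_iso (harmonic_system 11 8) (@offset_config 12 [set:: [:: 0; 1; 5]]).
  by apply: harmonic_iso; lazy.
have iso013 :
    config_iso (harmonic_system 10 9) (@offset_config 12 [set:: [:: 0; 1; 3]]).
  by apply: harmonic_iso; lazy.
have config_iso_refl X : config_iso X X.
  by exists id, id; split; try exists id.
have c014 : in_census (@offset_config 12 [set:: [:: 0; 1; 4]]).
  by apply: starter_census.
have c015 : in_census (@offset_config 12 [set:: [:: 0; 1; 5]]).
  by apply: starter_census.
have c013 : in_census (@offset_config 12 [set:: [:: 0; 1; 3]]).
  by apply: starter_census.
split.
- by split; apply: val_inj.
- split; [ | exact: not_config_iso_014_013 | ]; move=> /config_iso_ago.
    by rewrite ago_014 ago_015.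
  by rewrite ago_015 ago_013.
- split; last split; rewrite ?ago_014 //.
  + exact: config_iso_levi_iso.
  + by rewrite card_levi_aut_harmonic (config_iso_ago iso014) ago_014.
  + exact: offset_cyclic.
- split; last split; rewrite ?ago_015 //.
  + exact: config_iso_levi_iso.
  + by rewrite card_levi_aut_harmonic (config_iso_ago iso015) ago_015.
  + exact: offset_cyclic.
  move=> Y [confY _] cycY agoY.
  have [s sS Ys] := cyclic_configuration_starter confY cycY.
  move: sS (Ys) (config_iso_ago Ys); rewrite agoY !inE.
  by case/or3P => /eqP-> //; rewrite ?ago_014 ?ago_013.
split; last split; rewrite ?ago_013 //.
- exact: config_iso_levi_iso.
- by rewrite card_levi_aut_harmonic (config_iso_ago iso013) ago_013.
exact: offset_cyclic.
Qed.
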